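(* Let $F$ be a field of characteristic $2$ having a Galois extension with Galois group the Mathieu group $M_{24}$. Then there exists an irreducible polynomial $f\in F[x]$ of degree $24$ having Galois group $M_{24}$ over $F$ and satisfying $m(f)=23$ (with $q=2$).
   Context: A $2$-polynomial over a field $F$ of characteristic $2$ is a polynomial of the form $\sum_{i=0}^n a_i x^{2^i}\in F[x]$, and its $2$-degree is $n$ if $a_n\neq 0$. For $f\in F[x]$ with no repeated roots, $m(f)$ denotes the smallest $2$-degree of a nonzero monic $2$-polynomial in $F[x]$ that is divisible by $f$. *)

(* Defs.v *)
From mathcomp Require Import all_boot all_order all_algebra.
From mathcomp Require Import all_fingroup all_solvable all_field.

Set Implicit Arguments.
Unset Strict Implicit.
Unset Printing Implicit Defensive.

Import GRing.Theory.
Local Open Scope ring_scope.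

(* M_24 acts on the 24 points of the projective line over F_23, where [None]  *)
(* is the point at infinity.  It is generated by x |-> x + 1, x |-> - 1 / x   *)
(* and x |-> x^3 / 9 (x a square) or 9 x^3 (x not a square); the first two    *)
(* generate PSL_2(23).  See Conway and Sloane, Sphere Packings, Lattices and  *)
(* Groups, Chapter 10.                                                        *)
Definition PL23 : finType := option 'F_23.

Definition m24_alpha_fun (x : PL23) : PL23 :=
  if x is Some y then Some (y + 1) else None.

Definition m24_gamma_fun (x : PL23) : PL23 :=
  if x is Some y then (if y == 0 then None else Some (- y^-1)) else Some 0.

Definition is_square (y : 'F_23) : bool := [exists z : 'F_23, y == z ^+ 2].

Definition m24_delta_fun (x : PL23) : PL23 :=
  if x is Some y then Some (if is_square y then y ^+ 3 / 9 else 9 * y ^+ 3)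
  else None.

Lemma m24_alpha_inj : injective m24_alpha_fun.
Proof. by move=> [x|] [y|] //= /(@Some_inj _ _ _) /addIr->. Qed.

Lemma m24_gamma_inj : injective m24_gamma_fun.
Proof.
apply: (can_inj (g := m24_gamma_fun)) => -[x|] //=.
have [->|nz_x] //= := eqVneq x 0.
by rewrite oppr_eq0 invr_eq0 (negPf nz_x) invrN opprK invrK.
Qed.

Lemma F23_cubeK : cancel (fun y : 'F_23 => y ^+ 3) (fun y => y ^+ 15).
Proof.
move=> y; have e23 (z : 'F_23) : z ^+ 23 = z.
  by have := expf_card z; rewrite card_Fp.
rewrite -exprM -[(3 * 15)%N]/(23 + 22)%N exprD e23 -exprS; exact: e23.
Qed.

Lemma is_squareMX (c y : 'F_23) :
  c != 0 -> is_square (c ^+ 2 * y ^+ 3) = is_square y.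
Proof.
move=> nz_c; apply/existsP/existsP=> [[z /eqP Dz] | [z /eqP->]]; last first.
  by exists (c * z ^+ 3); apply/eqP; rewrite [RHS]exprMn exprAC.
have [->|nz_y] := eqVneq y 0; first by exists 0; rewrite expr0n.
exists (z / (c * y)); apply/eqP.
rewrite [RHS]expr_div_n -Dz [(c * y) ^+ 2]exprMn (exprS y 2) mulrCA mulfK //.
by rewrite mulf_neq0 ?expf_neq0.
Qed.

Lemma m24_delta_inj : injective m24_delta_fun.
Proof.
have nine : 9 = 3 ^+ 2 :> 'F_23 by apply/val_inj.
have nz3 : (3 : 'F_23) != 0 by [].
have sq y : is_square (if is_square y then y ^+ 3 / 9 else 9 * y ^+ 3)
            = is_square y.
  case: ifP => <-; rewrite nine; last exact: is_squareMX.
  by rewrite mulrC -exprVn is_squareMX ?invr_eq0.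
move=> [x|] [y|] //= /(@Some_inj _ _ _) Dxy; congr Some; apply: (can_inj F23_cubeK).
have Exy : is_square x = is_square y by rewrite -(sq x) Dxy sq.
move: Dxy; rewrite Exy; case: ifP => _.
  by apply: mulIf.
by apply: mulfI.
Qed.

Definition m24_alpha : {perm PL23} := perm m24_alpha_inj.
Definition m24_gamma : {perm PL23} := perm m24_gamma_inj.
Definition m24_delta : {perm PL23} := perm m24_delta_inj.

Definition M24 : {group {perm PL23}} :=
  <<[set m24_alpha; m24_gamma; m24_delta]>>%G.

(* [f] has no repeated roots and the Galois group over [F] of its splitting   *)
(* field is isomorphic to [G].                                                *)
Definition poly_has_galois_group (F : fieldType) (f : {poly F})
    (gT : finGroupType) (G : {group gT}) : Prop :=
  separable_poly f /\
  exists L : splittingFieldType F,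
    splittingFieldFor 1 (map_poly (in_alg L) f) {:L} /\
    'Gal({:L} / 1) \isog G.

Definition two_poly_of_degree (F : fieldType) (P : {poly F}) (n : nat) : Prop :=
  exists a : nat -> F,
    a n != 0 /\ P = \sum_(i < n.+1) a i *: 'X^(2 ^ i).

Definition min_two_degree (F : fieldType) (f : {poly F}) (n : nat) : Prop :=
  (exists P : {poly F},
     [/\ two_poly_of_degree P n, P \is monic & f %| P]) /\
  (forall (P : {poly F}) (k : nat),
     two_poly_of_degree P k -> P \is monic -> f %| P -> (n <= k)%N).

(* Main.v *)
Require Import Defs.
From HB Require Import structures.
From mathcomp Require Import all_boot all_order all_algebra.
From mathcomp Require Import all_fingroup all_solvable all_field.
From Stdlib Require Import Classical.

Set Implicit Arguments.
Unset Strict Implicit.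
Unset Printing Implicit Defensive.

Import GRing.Theory.
Local Open Scope ring_scope.

(* Of M_24 only this is used: it is nonabelian and acts transitively and      *)
(* faithfully on a set T of n + 1 > 2 points.  The roots of f are the sums    *)
(* a_i = \sum_(g x0 = i) g b, for i in T and a suitable b in L with trace 0.  *)
(* By independence of automorphisms, for A neither empty nor T the linear map *)
(* b |-> \sum_(i in A) a_i does not vanish on the trace zero hyperplane, and  *)
(* since F is infinite (Gal is not cyclic), some b avoids the kernels of all  *)
(* these maps.  Then the a_i are distinct and span an F_2-space of dimension  *)
(* n, all of whose elements are roots of any 2-polynomial that f divides, so  *)
(* m(f) >= n.  For m(f) <= n, the remainders modulo f of X^(2^j), j <= n, are *)
(* n + 1 polynomials in the proper subspace of those polynomials p of degree  *)
(* at most n such that \sum_i p(a_i) = 0, hence they are linearly dependent.  *)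

(** Everything rests on [transitive_galois_min_two_degree], which treats any nonabelian transitive
    permutation group of degree n + 1 > 2. The only F_2-linear relation among the roots given by
    [exists_independent_orbit] is that their total sum vanishes. A 2-polynomial is additive, so
    vanishing at the roots it vanishes on their span of 2^n elements: this is the lower bound,
    [two_poly_size_gt]. The same relation, raised to the powers 2^j, forces the dependence behind
    the upper bound, [exists_two_poly_multiple]. Irreducibility comes from transitivity, and the
    splitting field from faithfulness. *)

Lemma finite_gal_cyclic (F : fieldType) (L : splittingFieldType F) (s : seq F) :
  (forall x, x \in s) -> cyclic 'Gal({:L} / 1).
Proof.
(* F is destructed so that FF, rebuilt from its mixins, is convertible to it. *)
move: L s; destruct F as [T cF]; destruct cF => L s sF.
set F := GRing.Field.Pack _ in L s sF *.
have idxK : cancel (index^~ s) (nth (0 : F) s) by move=> x; rewrite nth_index.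
have finP : Finite.axiom (undup s).
  by move=> x; rewrite count_uniq_mem ?undup_uniq // mem_undup sF.
pose FF : finFieldType :=
  HB.pack_for finFieldType F (CanIsCountable idxK) (isFinite.Build F finP).
have [g [genG _]] := @finField_galois_generator FF L 1%AS {:L}%AS (subvf _).
by apply/cyclicP; exists g; apply/eqP; apply: genG.
Qed.

Lemma nonabelian_gal_infinite (F : fieldType) (L : splittingFieldType F) :
  ~~ abelian 'Gal({:L} / 1) -> forall s : seq F, exists x, x \notin s.
Proof.
move=> /negP nabG s; apply: NNPP => finF; case: nabG; apply: cyclic_abelian.
apply: (@finite_gal_cyclic _ _ s) => x.
by apply: contraT => s'x; case: finF; exists x.
Qed.

(** * Choice of the roots *)

(** The coordinate along 1 recovers x from [x%:A], so a finite list in [K] excludes only finitely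
    many scalars. *)
Lemma exists_scalar_notin (F : fieldType) (K : fieldExtType F) (t : seq K) :
  (forall t : seq F, exists x, x \notin t) -> exists x : F, x%:A \notin t.
Proof.
move=> infF; have [x] := infF [seq coord [tuple (1 : K)] ord0 y | y <- t].
move=> t'x; exists x; apply: contra t'x => tx; apply/mapP; exists x%:A => //.
rewrite linearZ /= (coord_free ord0 ord0) ?eqxx ?mulr1 //.
by rewrite seq1_free oner_neq0.
Qed.

(** A vector space over an infinite field is not a finite union of proper subspaces. *)
Lemma avoid_kernels (F : fieldType) (V : vectType F) (K : fieldExtType F)
    (I : eqType) (l : I -> 'Hom(V, K)) (U : {vspace V}) (s : seq I) :
    (forall t : seq F, exists x, x \notin t) ->
    {in s, forall i, ~~ (U <= lker (l i))%VS} ->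
  exists2 u, u \in U & {in s, forall i, l i u != 0}.
Proof.
move=> infF; elim: s => [|i s IHs] nzl; first by exists 0; rewrite ?mem0v.
have [|u Uu nzu] := IHs; first by move=> j sj; apply: nzl; rewrite inE sj orbT.
have /subvPn[v Uv] := nzl i (mem_head i s); rewrite memv_ker => nzv.
(* On the line u + x v each form [l j] with [l j v != 0] has one bad x. If [l j v = 0], the quotient
   is 0 and excluding it is harmless. *)
have [x bad'x] := exists_scalar_notin [seq - l j u / l j v | j <- i :: s] infF.
exists (u + x *: v); first by rewrite rpredD ?rpredZ.
move=> j sj; rewrite linearD linearZ /=.
have [l0|nzj] := eqVneq (l j v) 0.
  rewrite l0 scaler0 addr0; move: sj; rewrite inE => /predU1P[ji|/nzu//].
  by rewrite -ji l0 eqxx in nzv.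
apply: contra bad'x => /eqP l0; apply/mapP; exists j => //.
by apply: (mulIf nzj); rewrite mulfVK // mulr_algl; apply/esym/eqP; rewrite eqr_oppLR -addr_eq0 l0.
Qed.

Lemma exists_independent_orbit (F : fieldType) (L : splittingFieldType F)
    (T : finType) (phi : {morphism ('Gal({:L} / 1))%g >-> {perm T}}) :
    galois 1 {:L} -> (forall s : seq F, exists x, x \notin s) ->
    [transitive phi @* ('Gal({:L} / 1))%g, on [set: T] | 'P] ->
  exists a : T -> L,
    [/\ forall g i, g \in 'Gal({:L} / 1)%g -> g (a i) = a (phi g i),
        \sum_i a i = 0
      & forall A : {set T}, A != set0 -> A != setT -> \sum_(i in A) a i != 0].
Proof.
move=> galL infF /imsetP[x0 _ orbT].
have reach i : exists2 g, g \in 'Gal({:L} / 1)%g & phi g x0 = i.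
  have /orbitP[_ /morphimP[g _ Gg ->] <-] : i \in orbit 'P (phi @* ('Gal({:L} / 1))%g) x0.
    by rewrite -orbT inE.
  by exists g.
pose l (A : {set T}) : 'End(L) :=
  \sum_(g in 'Gal({:L} / 1)%g | phi g x0 \in A) (gal_repr g : 'End(L)).
have lE A b : l A b = \sum_(g in 'Gal({:L} / 1)%g | phi g x0 \in A) g b.
  by rewrite sum_lfunE.
have lTE b : l setT b = galTrace 1 {:L} b.
  by rewrite lE; apply: eq_bigl => g; rewrite inE andbT.
pose good := [pred A : {set T} | (A != set0) && (A != setT)].
(* If [l A] vanished on the trace zero hyperplane, it would be c times the trace. By independence of
   automorphisms the indicator of [phi g x0 \in A] would then equal c for every g, although A
   contains i and misses j. *)
have nzl : {in enum good, forall A, ~~ (lker (l setT) <= lker (l A))%VS}.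
  move=> A; rewrite mem_enum => /andP[/set0Pn[i Ai] ].
  rewrite -properT => /properP[_ [j _ A'j] ]; apply/negP => /subvP sUA.
  have [b0 _] := @gal_independent_contra _ _ {:L}%AS [in 'Gal({:L} / 1)%g]
    (fun=> 1) 1%g (group1 _) (oner_neq0 _).
  under eq_bigr do rewrite mul1r; rewrite -/(galTrace 1 {:L} b0) => nz_b0.
  pose c := l A b0 / galTrace 1 {:L} b0.
  have trF b : exists k, galTrace 1 {:L} b = k%:A.
    apply/vlineP; have := galTrace_fixedField 1 (memvf b).
    by rewrite (galois_fixedField galL).
  have lA b : l A b = c * galTrace 1 {:L} b.
    have [k kE] := trF b; have [k0 k0E] := trF b0.
    have nz_k0 : k0 != 0 by apply: contra nz_b0 => /eqP k00; rewrite k0E k00 scale0r.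
    have : b - (k / k0) *: b0 \in lker (l setT).
      rewrite memv_ker linearB linearZ /= !lTE kE k0E scalerA divfK //.
      by rewrite subrr.
    move/sUA; rewrite memv_ker linearB linearZ /= subr_eq0 => /eqP->.
    rewrite /c kE k0E mulrAC mulr_algr.
    apply: (canRL (mulfK _)); first by rewrite scaler_eq0 oner_eq0 orbF.
    by rewrite mulr_algr scalerA mulrC divfK.
  have cE g : g \in 'Gal({:L} / 1)%g -> (phi g x0 \in A)%:R - c = 0 :> L.
    move: g; apply: gal_independent => b _.
    under eq_bigr do rewrite mulrBl.
    rewrite sumrB -mulr_sumr -/(galTrace 1 {:L} b) -lA lE big_mkcondr /=.
    apply/eqP; rewrite subr_eq0; apply/eqP; apply: eq_bigr => g _.
    by case: ifP; rewrite ?mul1r ?mul0r.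
  have [g Gg gi] := reach i; have [h Gh hj] := reach j.
  have /eqP := cE g Gg; have /eqP := cE h Gh.
  rewrite gi hj Ai (negPf A'j) sub0r oppr_eq0 => /eqP->.
  by rewrite subr0 oner_eq0.
have [b kerb nzb] := avoid_kernels infF nzl.
pose a i := l [set i] b; exists a.
have aA (A : {set T}) : \sum_(i in A) a i = l A b.
  rewrite lE (partition_big (fun g => phi g x0) (mem A)) /=; last by move=> g /andP[].
  apply: eq_bigr => i Ai; rewrite /a lE; apply: eq_bigl => g.
  by rewrite in_set1; case: eqP => [->|]; rewrite ?Ai ?andbT ?andbF.
split=> [g i Gg| |A nzA nTA]; last 1 first.
- by rewrite aA nzb // mem_enum inE nzA.
- rewrite /a !lE rmorph_sum /= [RHS](reindex_inj (mulIg g)) /=.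
  apply: eq_big => [h|h _]; last by rewrite galM ?memvf.
  rewrite groupMr // !inE; case Gh: (h \in _) => //=.
  by rewrite morphM // permM (inj_eq perm_inj).
by move: kerb; rewrite memv_ker -aA => /eqP {2}<-; apply: eq_bigl => i; rewrite inE.
Qed.

(** * The polynomial with roots a_i *)

Section OrbitPolynomial.

Variables (F : fieldType) (L : splittingFieldType F) (T : finType).
Variables (phi : {morphism ('Gal({:L} / 1))%g >-> {perm T}}) (a : T -> L).
Hypothesis galL : galois 1 {:L}.
Hypothesis a_inj : injective a.
Hypothesis a_gal :
  forall g i, g \in ('Gal({:L} / 1))%g -> g (a i) = a (phi g i).

Lemma gal_fixed_in_base x :
  (forall g, g \in ('Gal({:L} / 1))%g -> g x = x) -> exists k, x = k%:A.
Proof.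
move=> fix_x; apply/vlineP; rewrite -(galois_fixedField galL).
exact/(fixedFieldP (memvf x)).
Qed.

Lemma orbit_polynomial :
  exists f : {poly F}, map_poly (in_alg L) f = \prod_i ('X - (a i)%:P).
Proof.
suff /polyOver1P[f ->] : \prod_i ('X - (a i)%:P) \is a polyOver (1%VS : {vspace L}).
  by exists f.
apply/polyOverP => k; apply/vlineP; apply: gal_fixed_in_base => g Gg.
rewrite -(coef_map g) rmorph_prod [in RHS](reindex_inj (@perm_inj _ (phi g))) /=.
under eq_bigr => i _ do rewrite rmorphB /= map_polyX map_polyC /= a_gal //.
by [].
Qed.

Variable f : {poly F}.
Hypothesis fE : map_poly (in_alg L) f = \prod_i ('X - (a i)%:P).

Lemma size_orbit_polynomial : size f = #|T|.+1.
Proof.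
by rewrite -(size_map_poly (in_alg L)) fE size_prod_XsubC /index_enum -enumT -cardE.
Qed.

Let fE_seq :
  map_poly (in_alg L) f = \prod_(z <- [seq a i | i <- enum T]) ('X - z%:P).
Proof. by rewrite fE big_map big_enum. Qed.

Let uniq_a : uniq [seq a i | i <- enum T].
Proof. by rewrite map_inj_uniq ?enum_uniq. Qed.

Lemma orbit_polynomial_separable : separable_poly f.
Proof. by rewrite -(separable_map (in_alg L)) fE_seq separable_prod_XsubC. Qed.

Lemma dvd_orbit_polynomial (P : {poly F}) :
  reflect (forall i, root (map_poly (in_alg L) P) (a i)) (f %| P).
Proof.
rewrite -(dvdp_map (in_alg L)) fE_seq.
apply: (iffP idP) => [fP i | rootP].
  rewrite -dvdp_XsubCl; apply: dvdp_trans fP; rewrite dvdp_XsubCl root_prod_XsubC.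
  by rewrite (map_f a) ?mem_enum.
apply: uniq_roots_dvdp; last by rewrite uniq_rootsE.
by apply/allP => _ /mapP[i _ ->].
Qed.

(** A nonconstant divisor q has some root a_i. Automorphisms fix the coefficients of q, so
    transitivity makes every a_j a root of q. *)
Lemma orbit_polynomial_irreducible :
    [transitive phi @* ('Gal({:L} / 1))%g, on [set: T] | 'P] ->
  irreducible_poly f.
Proof.
move=> trG; have [x0 _ _] := imsetP trG.
have T_gt0 : (0 < #|T|)%N by apply/card_gt0P; exists x0.
split; first by rewrite size_orbit_polynomial ltnS.
move=> q q_n1 qf; rewrite /eqp qf /=; apply/dvd_orbit_polynomial => j.
have : map_poly (in_alg L) q %| \prod_i ('X - (a i)%:P) by rewrite -fE dvdp_map.
case/dvdp_prod_XsubC => m qE.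
have [i qi] : exists i, root (map_poly (in_alg L) q) (a i).
  case: (mask m _) qE => [|i r] qE; last first.
    by exists i; rewrite (eqp_root qE) big_cons rootM root_XsubC eqxx.
  move: q_n1; rewrite -(size_map_poly (in_alg L)) (eqp_size qE) big_nil.
  by rewrite size_poly1.
have /orbitP[_ /morphimP[g _ Gg ->] <-] :
    j \in orbit 'P (phi @* ('Gal({:L} / 1))%g) i.
  by rewrite (atransP trG) inE.
rewrite /= /aperm -a_gal //.
have qg : map_poly g (map_poly (in_alg L) q) = map_poly (in_alg L) q.
  rewrite -map_poly_comp; apply: eq_map_poly => x /=.
  by rewrite linearZ /= rmorph1.
by rewrite -qg fmorph_root.
Qed.

(** An automorphism fixing every a_i acts trivially on [T], hence is 1 by faithfulness. The field
    generated by the roots is thus the fixed field of the trivial group. *)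
Lemma orbit_polynomial_splits :
  ('injm phi)%g -> splittingFieldFor 1 (map_poly (in_alg L) f) {:L}.
Proof.
move=> injphi; exists [seq a i | i <- enum T]; first by rewrite fE_seq eqpxx.
pose K := <<1 & [seq a i | i <- enum T]>>%AS.
have galK : galois K {:L} by apply: galoisS galL; rewrite sub1v subvf.
have K_id : 'Gal({:L} / K)%g = 1%g.
  apply/trivgP/subsetP => g Kg.
  have Gg : g \in ('Gal({:L} / 1))%g by apply: subsetP Kg; rewrite galS ?sub1v.
  rewrite inE -(inj_in_eq (injmP injphi)) ?group1 // morph1.
  apply/eqP/permP => i; rewrite perm1; apply: a_inj; rewrite -a_gal //.
  by apply: (fixed_gal (subvf K) Kg); apply: seqv_sub_adjoin; rewrite map_f ?mem_enum.
rewrite -[LHS](galois_fixedField galK : _ = K :> {vspace L}) K_id.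
apply/eqP; rewrite eqEsubv subvf /=; apply/subvP => x _.
by apply/fixedFieldP; rewrite ?memvf // => g /set1P->; rewrite gal_id.
Qed.

End OrbitPolynomial.

(** * Additivity of 2-polynomials and the lower bound *)

Lemma expr_sum_pchar2 (K : fieldType) (j : nat) (I : Type) (r : seq I)
    (Q : pred I) (x : I -> K) :
  2%N \in [pchar K] ->
  (\sum_(i <- r | Q i) x i) ^+ (2 ^ j) = \sum_(i <- r | Q i) x i ^+ (2 ^ j).
Proof.
move=> charK2; apply: (big_morph (fun y => y ^+ (2 ^ j))) => [y z|].
  by rewrite exprDn_pchar // pnatX /= pnatE // charK2.
by rewrite expr0n expn_eq0.
Qed.

Lemma horner_two_poly_sum (K : fieldType) (m : nat) (c : 'I_m -> K)
    (I : Type) (r : seq I) (Q : pred I) (x : I -> K) :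
  2%N \in [pchar K] -> let P := \sum_(j < m) c j *: 'X^(2 ^ j) in
  P.[\sum_(i <- r | Q i) x i] = \sum_(i <- r | Q i) P.[x i].
Proof.
move=> charK2 P.
have PE y : P.[y] = \sum_(j < m) c j * y ^+ (2 ^ j).
  by rewrite horner_sum; apply: eq_bigr => j _; rewrite hornerZ hornerXn.
under [RHS]eq_bigr do rewrite PE.
rewrite PE exchange_big; apply: eq_bigr => j _.
by rewrite expr_sum_pchar2 // mulr_sumr.
Qed.

Lemma two_poly_size_gt (K : fieldType) (T : finType) (a : T -> K) (n m : nat)
    (c : 'I_m -> K) :
    2%N \in [pchar K] -> #|T| = n.+1 ->
    (forall A : {set T}, A != set0 -> A != setT -> \sum_(i in A) a i != 0) ->
    let P := \sum_(j < m) c j *: 'X^(2 ^ j) in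
  P != 0 -> (forall i, root P (a i)) -> (2 ^ n < size P)%N.
Proof.
move=> charK2 cardT indep P nzP Pa.
have /card_gt0P[x0 _] : (0 < #|T|)%N by rewrite cardT.
(* Only subsets avoiding [x0] are used, so that the symmetric difference of two of them is never all
   of [T]. In characteristic 2 the difference of their sums is the sum over that symmetric
   difference. *)
pose D := powerset (~: [set x0]); pose S (A : {set T}) := \sum_(i in A) a i.
have injS : {in enum D &, injective S}.
  move=> A B; rewrite !mem_enum !inE => sA sB /eqP.
  rewrite -subr_eq0 /S (big_setID B) [X in _ - X](big_setID A) /= setIC [X in X - _]addrC addrKA.
  rewrite oppr_pchar2 // => sum0.
  pose C := (A :\: B) :|: (B :\: A).
  have dis : [disjoint A :\: B & B :\: A].
    by rewrite -setI_eq0; apply/eqP/setP => i; rewrite !inE; do 2!case: (i \in _).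
  have CT : C != setT.
    have not_x0 (E : {set T}) : E \subset ~: [set x0] -> x0 \in E = false.
      by move/subsetP/(_ x0) => sE; apply/negP => /sE; rewrite !inE eqxx.
    by apply/eqP => /setP/(_ x0); rewrite !inE !not_x0.
  have : C == set0.
    apply: contraTT sum0 => nzC; have := indep C nzC CT.
    suff -> : \sum_(i in C) a i = S (A :\: B) + S (B :\: A) by [].
    by rewrite -bigU //=; apply: eq_bigl => i; rewrite !inE.
  by rewrite setU_eq0 !setD_eq0 => /andP[sAB sBA]; apply/eqP; rewrite eqEsubset sAB.
have <- : size [seq S A | A <- enum D] = (2 ^ n)%N.
  by rewrite size_map -cardE card_powerset cardsC1 cardT.
apply: max_poly_roots => //; last by rewrite map_inj_in_uniq ?enum_uniq.
apply/allP => _ /mapP[A _ ->].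
by rewrite rootE horner_two_poly_sum // big1 // => i _; apply/rootP.
Qed.

(** * A 2-polynomial multiple of f, by linear algebra *)

Section PowerSums.

Variables (F : fieldType) (L : splittingFieldType F) (T : finType).
Variables (phi : {morphism ('Gal({:L} / 1))%g >-> {perm T}}) (a : T -> L).
Hypothesis galL : galois 1 {:L}.
Hypothesis a_inj : injective a.
Hypothesis a_gal :
  forall g i, g \in ('Gal({:L} / 1))%g -> g (a i) = a (phi g i).
Hypothesis a_sum : \sum_i a i = 0.
Hypothesis charF2 : 2%N \in [pchar F].
Variables (f : {poly F}) (n : nat).
Hypothesis fE : map_poly (in_alg L) f = \prod_i ('X - (a i)%:P).
Hypothesis cardT : #|T| = n.+1.

Lemma exists_two_poly_multiple :
  exists c : 'I_n.+1 -> F, let P := \sum_(j < n.+1) c j *: 'X^(2 ^ j) in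
  P != 0 /\ f %| P.
Proof.
have charL2 : 2%N \in [pchar L] by rewrite pchar_lalg.
have f_nz : f != 0 by rewrite -size_poly_gt0 (size_orbit_polynomial fE).
have size_modf p : (size (p %% f)%R <= n.+1)%N.
  by rewrite -cardT -ltnS -(size_orbit_polynomial fE) ltn_modp.
have fa i : (map_poly (in_alg L) f).[a i] = 0.
  by apply/rootP; rewrite fE (bigD1 i) //= rootM root_XsubC eqxx.
have modf_a p i :
    (map_poly (in_alg L) (p %% f)).[a i] = (map_poly (in_alg L) p).[a i].
  by rewrite [in RHS](divp_eq p f) rmorphD rmorphM hornerD hornerM fa mulr0 add0r.
have ts k : exists x : F, \sum_i a i ^+ k = x%:A.
  apply: (gal_fixed_in_base galL) => g Gg; rewrite rmorph_sum.
  rewrite [RHS](reindex_inj (@perm_inj _ (phi g))).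
  by apply: eq_bigr => i _; rewrite rmorphXn /= a_gal.
have [t tE] := fin_all_exists (fun k : 'I_n.+1 => ts k).
have sum_horner (p : {poly L}) : (size p <= n.+1)%N ->
    \sum_i p.[a i] = \sum_(k < n.+1) p`_k * (t k)%:A.
  move=> sp; under eq_bigr do rewrite (horner_coef_wide _ sp).
  by rewrite exchange_big; apply: eq_bigr => k _; rewrite -mulr_sumr tE.
(* Pairing the coefficients of p with the vector of power sums gives the sum of the values
   p(a_i). *)
pose tv := \col_k t k.
have nz_t : tv != 0.
  have /card_gt0P[x0 _] : (0 < #|T|)%N by rewrite cardT.
  (* This p is nonzero at exactly one root, so the sum of its values is nonzero. *)
  pose p := \prod_(i | i != x0) ('X - (a i)%:P).
  have sp : (size p <= n.+1)%N.
    rewrite /p size_prod => [|i _]; last by rewrite polyXsubC_eq0.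
    under eq_bigr do rewrite size_XsubC.
    by rewrite sum_nat_const cardC1 cardT /= muln2 -addnn subSn ?addnK // leq_addr.
  have : \sum_i p.[a i] != 0.
    rewrite (bigD1 x0) //= big1 ?addr0; last first.
      by move=> i ni; apply/rootP; rewrite /p (bigD1 i) //= rootM root_XsubC eqxx.
    rewrite horner_prod prodf_seq_neq0; apply/allP => i _; apply/implyP => ni.
    by rewrite hornerXsubC subr_eq0 (inj_eq a_inj) eq_sym.
  rewrite sum_horner //; apply: contraNneq => t0; apply/eqP; apply: big1 => k _.
  by have /colP/(_ k) := t0; rewrite !mxE => ->; rewrite scale0r mulr0.
pose C := \matrix_(j < n.+1, k < n.+1) ('X^(2 ^ j) %% f)`_k.
(* Row j pairs to the sum of the a_i^(2^j), which is (sum of the a_i)^(2^j) = 0. Hence [C] is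
   singular, and a vector in its left kernel gives the combination divisible by f. *)
have Ct : C *m tv = 0.
  apply/colP => j; rewrite !mxE; apply: (fmorph_inj (in_alg L)); rewrite rmorph0.
  rewrite rmorph_sum /=.
  transitivity (\sum_i (map_poly (in_alg L) ('X^(2 ^ j) %% f)).[a i]).
    rewrite sum_horner; last by rewrite size_map_poly.
    apply: eq_bigr => k _; rewrite !mxE coef_map /=.
    by rewrite mulr_algl scalerA.
  under eq_bigr do rewrite modf_a map_polyXn hornerXn.
  by rewrite -expr_sum_pchar2 // a_sum expr0n expn_eq0.
have /eqP/det0P[u nz_u uC] : \det C = 0.
  apply/eqP; apply: contraNT nz_t; rewrite -unitfE -unitmxE => unitC.
  by rewrite -[tv](mulKmx unitC) Ct mulmx0.
exists (u 0); set P := \sum_(j < _) _.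
have P_coef (j : 'I_n.+1) : P`_(2 ^ j) = u 0 j.
  rewrite coef_sum (bigD1 j) //= coefZ coefXn eqxx mulr1 big1 ?addr0 // => k kj.
  by rewrite coefZ coefXn eqn_exp2l // eq_sym (inj_eq val_inj) (negPf kj) mulr0.
split.
  apply: contraNneq nz_u => P0; apply/eqP/rowP => j.
  by rewrite -P_coef P0 coef0 mxE.
apply/eqP/polyP => k; rewrite coef0.
have [kn|kn] := ltnP k n.+1; last first.
  by rewrite nth_default // (leq_trans (size_modf _)).
have /rowP/(_ (Ordinal kn)) := uC; rewrite !mxE => uCk.
rewrite (big_morph _ (modpD f) (mod0p f)) coef_sum -[RHS]uCk; apply: eq_bigr => j _.
by rewrite modpZl coefZ !mxE.
Qed.

End PowerSums.

Lemma size_two_poly (K : fieldType) (m : nat) (c : nat -> K) :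
  (size (\sum_(j < m.+1) c j *: 'X^(2 ^ j))%R <= (2 ^ m).+1)%N.
Proof.
apply: leq_trans (size_sum _ _ _) _; apply/bigmax_leqP => j _.
apply: leq_trans (size_scale_leq _ _) _.
by rewrite size_polyXn ltnS leq_exp2l // -ltnS.
Qed.

(** * Assembly for a general group, then the case of M_24 *)

Lemma transitive_galois_min_two_degree (F : fieldType) (L : splittingFieldType F)
    (T : finType) (G : {group {perm T}}) (n : nat) :
    2%N \in [pchar F] -> galois 1 {:L} -> 'Gal({:L} / 1) \isog G ->
    [transitive G, on [set: T] | 'P] -> ~~ abelian G ->
    #|T| = n.+1 -> (1 < n)%N ->
  exists f : {poly F},
    [/\ irreducible_poly f, size f = n.+2, poly_has_galois_group f G
      & min_two_degree f n].
Proof.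
move=> charF2 galL isoG trG nabG cardT n_gt1.
have infF : forall s : seq F, exists x, x \notin s.
  by apply: (@nonabelian_gal_infinite F L); rewrite (isog_abelian isoG).
have /isogP[phi injphi phiG] := isoG; rewrite -phiG in trG.
have [a [a_gal a_sum indep]] := exists_independent_orbit galL infF trG.
have charL2 : 2%N \in [pchar L] by rewrite pchar_lalg.
(* Equal values at i and j would make a_i + a_j = 0 in characteristic 2, while the pair is a proper
   subset because n > 1. *)
have a_inj : injective a.
  move=> i j aij; apply/eqP/contraT => nij.
  have /negP[] : \sum_(k in [set i; j]) a k != 0.
    apply: indep; first by apply/set0Pn; exists i; rewrite !inE eqxx.
    apply: contraTneq n_gt1 => /(congr1 (fun A : {set T} => #|A|)).
    by rewrite cards2 cardsT cardT nij => -[<-].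
  by rewrite big_setU1 ?inE //= big_set1 -aij -mulr2n mulrn_pchar.
have [f fE] := orbit_polynomial galL a_gal.
have size_multiple (P : {poly F}) m (c : nat -> F) :
    P = \sum_(j < m) c j *: 'X^(2 ^ j) -> P != 0 -> f %| P -> (2 ^ n < size P)%N.
  move=> PE nzP /(dvd_orbit_polynomial a_inj fE) Pa.
  have PLE : map_poly (in_alg L) P = \sum_(j < m) (c j)%:A *: 'X^(2 ^ j).
    rewrite PE rmorph_sum /=; apply: eq_bigr => j _.
    by rewrite map_polyZ /= map_polyXn.
  rewrite -(size_map_poly (in_alg L)) PLE.
  apply: (two_poly_size_gt charL2 cardT indep); rewrite -PLE //.
  by rewrite map_poly_eq0.
exists f; split.
- exact: (orbit_polynomial_irreducible a_inj a_gal fE trG).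
- by rewrite (size_orbit_polynomial fE) cardT.
- split; first exact: (orbit_polynomial_separable a_inj fE).
  exists L; split=> //; exact: (orbit_polynomial_splits galL a_inj a_gal fE injphi).
have [c0 [nzP fP]] := exists_two_poly_multiple galL a_inj a_gal a_sum charF2 fE cardT.
pose c j := c0 (inord j).
have PE : \sum_(j < n.+1) c0 j *: 'X^(2 ^ j) = \sum_(j < n.+1) c j *: 'X^(2 ^ j).
  by apply: eq_bigr => j _; rewrite /c inord_val.
rewrite {}PE in nzP fP; set P := \sum_(j < _) _ in nzP fP.
split; last first.
  move=> Q k [d [_ QE]] /monic_neq0 nzQ fQ.
  have := leq_trans (size_multiple _ _ _ QE nzQ fQ); rewrite QE.
  by move/(_ _ (size_two_poly _ _)); rewrite ltnS leq_exp2l.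
(* The lower bound meets the obvious upper bound on the size, so the coefficient [c n] is nonzero
   and P can be made monic. *)
have sizeP : size P = (2 ^ n).+1.
  by apply/eqP; rewrite eqn_leq size_two_poly (size_multiple P n.+1 c).
have lcP : lead_coef P = c n.
  rewrite /lead_coef sizeP /= coef_sum (bigD1 ord_max) //= coefZ coefXn eqxx mulr1.
  rewrite big1 ?addr0 // => j nj.
  by rewrite coefZ coefXn eqn_exp2l // eq_sym (inj_eq val_inj j ord_max) (negPf nj) mulr0.
have nz_cn : c n != 0 by rewrite -lcP lead_coef_eq0.
exists ((c n)^-1 *: P); split; last by rewrite dvdpZr ?invr_eq0.
- exists (fun j => (c n)^-1 * c j); split; first by rewrite mulVf ?oner_eq0.
  by rewrite scaler_sumr; apply: eq_bigr => j _; rewrite scalerA.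
by rewrite monicE lead_coefZ lcP mulVf.
Qed.

Lemma M24_generators : m24_alpha \in M24 /\ m24_gamma \in M24.
Proof. by split; rewrite mem_gen // !inE eqxx ?orbT. Qed.

Lemma M24_transitive : [transitive M24, on [set: PL23] | 'P].
Proof.
have [Ma Mg] := M24_generators.
apply/imsetP; exists None => //; apply/esym/setP => -[y|]; last by rewrite orbit_refl inE.
(* [m24_gamma] sends infinity to 0, and y translations then reach y. *)
rewrite inE; apply/orbitP; exists (m24_gamma * m24_alpha ^+ y)%g.
  by rewrite groupM ?groupX.
have alphaX k : (m24_alpha ^+ k)%g (Some 0) = Some k%:R.
  elim: k => [|k IHk]; first by rewrite expg0 perm1.
  by rewrite expgSr permM IHk permE /= -natr1.
by rewrite /= /aperm permM [m24_gamma _]permE /= alphaX natr_Zp.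
Qed.

Lemma M24_nonabelian : ~~ abelian M24.
Proof.
have [Ma Mg] := M24_generators.
(* At infinity, [m24_alpha] followed by [m24_gamma] gives 0, and the reverse order gives 1. *)
apply/negP => /centsP/(_ _ Ma _ Mg)/(congr1 (fun s : {perm PL23} => s None)).
by rewrite !permM !permE.
Qed.

Theorem theorem28 (F : fieldType) (charF2 : 2%N \in [pchar F])
    (L : splittingFieldType F) (galL : galois 1 {:L})
    (galL_M24 : 'Gal({:L} / 1) \isog M24) :
  exists f : {poly F},
    [/\ irreducible_poly f,
        size f = 25%N,
        poly_has_galois_group f M24
      & min_two_degree f 23].
Proof.
apply: (transitive_galois_min_two_degree charF2 galL galL_M24 M24_transitive
  M24_nonabelian) => //.
by rewrite card_option card_Fp.
Qed.
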